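(* Let $n\geq 2$ be a positive integer. Then $$\det(\mathrm{lcir}(\boldsymbol{c}_n(i)))=\begin{cases}0 & \text{if } n\equiv 0 \pmod 4,\\ (2i)^{\frac{n-1}{2}} & \text{if } n\equiv 1\pmod 4\text{ or } n\equiv 3\pmod 4,\\ 2^{n-1} & \text{if } n\equiv 2\pmod 4.\end{cases}$$
   Context: Here $i$ is the imaginary unit. For $\boldsymbol{a}=(a_0,a_1,\dots,a_{n-1})\in\mathbb{C}^n$, $\mathrm{lcir}(\boldsymbol{a})$ denotes the $n\times n$ complex left circulant matrix with first row $\boldsymbol{a}$, each subsequent row being the preceding row rotated one position to the left; i.e., indexing rows and columns by $0,\dots,n-1$, its $(j,k)$ entry is $a_{(j+k)\bmod n}$. For a nonzero complex number $z$, $\boldsymbol{c}_n(z)=\left(\binom{n-1}{0}z^0,\binom{n-1}{1}z^1,\dots,\binom{n-1}{n-1}z^{n-1}\right)\in\mathbb{C}^n$ is the vector of coefficients of $(x+zy)^{n-1}$. *)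

(* Defs.v *)
From mathcomp Require Export all_boot all_order all_algebra.
From mathcomp Require Export reals complex.

Set Implicit Arguments.
Unset Strict Implicit.
Unset Printing Implicit Defensive.

Import GRing.Theory.
Local Open Scope ring_scope.

Definition lcir_index (n : nat) (j k : 'I_n) : 'I_n :=
  Ordinal (ltn_pmod (j + k) (leq_ltn_trans (leq0n j) (ltn_ord j))).

Definition lcir (T : Type) (n : nat) (a : 'rV[T]_n) : 'M[T]_n :=
  \matrix_(j < n, k < n) a ord0 (lcir_index j k).

(* Coefficients of (x + z y)^(n - 1); meant for 0 < n. *)
Definition cvec (K : comNzRingType) (n : nat) (z : K) : 'rV[K]_n :=
  \row_(k < n) ('C(n.-1, k)%:R * z ^+ k).

(* Main.v *)
(** For an n-th root of unity x, row j of lcir a sends (x^k)_k to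
    x^-j * \sum_k a_k x^k.  Since x^-j = x * x^(n-1-j), a left circulant
    matrix times the Vandermonde matrix V of the n-th roots of unity is
    J *m V *m D, with J the exchange matrix and D diagonal with entries
    x * \sum_k a_k x^k.  Cancelling det V and using
    \prod_x (1 + z x) = 1 - (-z)^n for a = cvec n z yields
    det (lcir (cvec n z)) = (-1)^C(n-1, 2) (1 - (-z)^n)^(n-1). *)

Require Import Defs.
From mathcomp Require Import all_boot all_order all_algebra.
From mathcomp Require Import reals complex.
From mathcomp Require Import cyclic separable cyclotomic.

Set Implicit Arguments.
Unset Strict Implicit.
Unset Printing Implicit Defensive.

Import GRing.Theory Num.Theory.
Local Open Scope ring_scope.

(** When [n] is nonzero in [F], ['X^n - 1] is separable, so its [n] roots are distinct, and [n]
    distinct [n]-th roots of unity include a primitive one. *)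
Lemma closed_prim_root_exists (F : closedFieldType) (n : nat) :
  n%:R != 0 :> F -> exists w : F, n.-primitive_root w.
Proof.
move=> nz_n; have n_gt0 : (0 < n)%N by case: n nz_n => //; rewrite eqxx.
pose p : {poly F} := 'X^n - 1; have [r Dp] := closed_field_poly_normal p.
rewrite (monicP _) ?monicXnsubC // scale1r in Dp.
have rn1 : all n.-unity_root r by apply/allP=> z; rewrite -root_prod_XsubC -Dp.
have sz_r : (n < (size r).+1)%N.
  by rewrite -(size_prod_XsubC r id) -Dp size_XnsubC.
have [|w] := hasP (has_prim_root n_gt0 rn1 _ sz_r); last by exists w.
by rewrite -separable_prod_XsubC -Dp separable_Xn_sub_1.
Qed.

(** Induction along the first row: its only nonzero entry is the last, with cofactor sign
    [(-1) ^+ n] and the exchange matrix of size [n] as minor; [C(n+1, 2) = n + C(n, 2)]. *)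
Lemma det_antidiag (A : comNzRingType) (n : nat) :
  \det (\matrix_(i < n, j < n) ((i + j).+1 == n)%:R) = (-1) ^+ 'C(n, 2) :> A.
Proof.
elim: n => [|n IHn]; first by rewrite det_mx00.
rewrite (expand_det_row _ ord0) (bigD1 ord_max) //= big1 => [|j nj]; last first.
  rewrite mxE add0n eqSS -[n in _ == n]/(val (@ord_max n)) val_eqE.
  by rewrite (negPf nj) mul0r.
rewrite mxE eqxx mul1r addr0 /cofactor add0n binS bin1 addnC exprD -IHn.
congr (_ * \det _); apply/matrixP => i j; rewrite !mxE /= /bump leq0n.
by rewrite leqNgt ltn_ord add0n add1n addSn eqSS.
Qed.

Lemma mul_antidiag (A : comNzRingType) (n p : nat) (M : 'M[A]_(n, p)) i j :
  ((\matrix_(i < n, j < n) ((i + j).+1 == n)%:R) *m M) i j = M (rev_ord i) j.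
Proof.
rewrite mxE (bigD1 (rev_ord i)) //= big1 => [|k nk]; rewrite !mxE.
  by rewrite -addnS subnSK // subnKC 1?ltnW // eqxx mul1r addr0.
rewrite (_ : (_ == n) = false) ?mul0r //; apply: contraNF nk => /eqP Dn.
apply/eqP/val_inj => /=; apply/eqP; rewrite -(eqn_add2l i.+1) subnKC //.
by rewrite addSn Dn.
Qed.

Lemma prod_sub_prim_root (F : fieldType) (n : nat) (w x : F) :
  n.-primitive_root w -> \prod_(i < n) (x - w ^+ i) = x ^+ n - 1.
Proof.
move=> prim_w; transitivity (\prod_(0 <= i < n) ('X - (w ^+ i)%:P)).[x].
  rewrite big_mkord horner_prod.
  by apply: eq_bigr => i _; rewrite hornerXsubC.
rewrite (factor_Xn_sub_1 prim_w).
by rewrite hornerD hornerN hornerXn hornerC.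
Qed.

(** Evaluates the factorization of ['X^n - 1] at 0. *)
Lemma prod_prim_root (F : fieldType) (n : nat) (w : F) :
  n.-primitive_root w -> \prod_(i < n) w ^+ i = (-1) ^+ n.-1.
Proof.
move=> prim_w; have n_gt0 := prim_order_gt0 prim_w.
have := prod_sub_prim_root 0 prim_w; rewrite expr0n gtn_eqF // sub0r.
under eq_bigr do rewrite sub0r -mulN1r.
rewrite big_split prodr_const card_ord -{1}(prednK n_gt0) exprS /=.
rewrite mulN1r mulNr => /oppr_inj e.
by apply: (@lreg_sign F n.-1); rewrite e -expr2 sqrr_sign.
Qed.

(** Pulling [- z] out of each factor leaves ['X^n - 1] evaluated at [(- z)^-1]. *)
Lemma prod_1Dprim_root (F : fieldType) (n : nat) (w z : F) :
  n.-primitive_root w -> z != 0 ->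
  \prod_(i < n) (1 + z * w ^+ i) = 1 - (- z) ^+ n.
Proof.
move=> prim_w nz_z.
transitivity (\prod_(i < n) (- z * ((- z)^-1 - w ^+ i))).
  by apply: eq_bigr => i _; rewrite mulrBr divff ?oppr_eq0 // mulNr opprK.
rewrite big_split prodr_const card_ord prod_sub_prim_root //=.
by rewrite mulrBr mulr1 exprVn divff // expf_neq0 ?oppr_eq0.
Qed.

Lemma sum_cvec (K : comNzRingType) (m : nat) (z x : K) :
  \sum_(k < m.+1) cvec m.+1 z ord0 k * x ^+ k = (1 + z * x) ^+ m.
Proof.
rewrite exprDn; apply: eq_bigr => k _; rewrite mxE expr1n mul1r exprMn.
by rewrite -mulrA mulr_natl.
Qed.

(** As [x ^+ n = 1], [x^j x^k] depends only on [(j + k) mod n], and adding [j] modulo [n] permutes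
    the indices. *)
Lemma lcir_eval (K : comNzRingType) (n : nat) (a : 'rV[K]_n) (x : K)
    (j : 'I_n) :
  x ^+ n = 1 ->
  x ^+ j * (\sum_k lcir a j k * x ^+ k) = \sum_k a ord0 k * x ^+ k.
Proof.
move=> xn1.
have inj_j : injective (@lcir_index n j).
  move=> k1 k2 /(congr1 val)/eqP /=; rewrite eqn_modDl !modn_small // => /eqP.
  exact: val_inj.
rewrite [RHS](reindex_inj inj_j) mulr_sumr; apply: eq_bigr => k _ /=.
by rewrite mxE mulrCA -exprD (expr_mod _ xn1).
Qed.

Lemma lcir_mul_Vandermonde (F : fieldType) (m : nat) (a d : 'rV[F]_m.+1) :
  (forall k, d 0 k ^+ m.+1 = 1) ->
  lcir a *m Vandermonde m.+1 d =
  (\matrix_(i < m.+1, j < m.+1) ((i + j).+1 == m.+1)%:R) *m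
    (Vandermonde m.+1 d *m
     diag_mx (\row_k (d 0 k * \sum_l a ord0 l * d 0 k ^+ l))).
Proof.
move=> dn1; apply/matrixP => j k; rewrite mul_antidiag mul_mx_diag !mxE /=.
have nz_d : d 0 k != 0.
  by apply: contra_eqN (dn1 k) => /eqP ->; rewrite expr0n eq_sym oner_eq0.
(* With [x = d 0 k], the factor [x^j] makes [lcir_eval] apply on the left; on the right the
   exponents [j], [m - j] and 1 add up to [m.+1]. *)
apply: (mulfI (expf_neq0 j nz_d)).
under eq_bigr do rewrite [Vandermonde _ _ _ _]mxE.
rewrite lcir_eval // !mulrA -exprD -exprSr subSS subnKC -1?ltnS //.
by rewrite dn1 mul1r.
Qed.

Lemma det_lcir_cvec (F : fieldType) (m : nat) (w z : F) :
  m.+1.-primitive_root w -> z != 0 ->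
  \det (lcir (cvec m.+1 z)) = (-1) ^+ 'C(m, 2) * (1 - (- z) ^+ m.+1) ^+ m.
Proof.
move=> prim_w nz_z; pose d : 'rV[F]_m.+1 := \row_k w ^+ k.
have dn1 k : d 0 k ^+ m.+1 = 1.
  by rewrite mxE -exprM mulnC exprM (prim_expr_order prim_w) expr1n.
have nz_V : \det (Vandermonde m.+1 d) != 0.
  rewrite det_Vandermonde; apply/prodf_neq0 => i _; apply/prodf_neq0 => j ij.
  rewrite !mxE subr_eq0 (eq_prim_root_expr prim_w) !modn_small //.
  by rewrite gtn_eqF.
apply: (mulIf nz_V); rewrite -det_mulmx lcir_mul_Vandermonde //.
rewrite !det_mulmx det_antidiag det_diag mulrCA mulrC; congr (_ * _).
under eq_bigr do rewrite mxE sum_cvec mxE.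
rewrite big_split prodrXl prod_prim_root //= prod_1Dprim_root // mulrA -exprD.
(* The signs of the exchange matrix and of the product of the roots combine:
   [C(m+1, 2) + m = C(m, 2) + 2m]. *)
by rewrite binS bin1 -addnA exprD addnn -(signr_odd _ m.*2) odd_double mulr1.
Qed.

Theorem theorem4p3 (R : realType) (n : nat) (hn : (2 <= n)%N) :
  [/\ n = 0 %[mod 4] ->
        \det (lcir (cvec n ('i%C : R[i]))) = 0,
      n = 1 %[mod 4] \/ n = 3 %[mod 4] ->
        \det (lcir (cvec n ('i%C : R[i]))) = (2 * 'i%C) ^+ (n.-1 %/ 2)
    & n = 2 %[mod 4] ->
        \det (lcir (cvec n ('i%C : R[i]))) = 2 ^+ n.-1].
Proof.
case: n hn => // m m_gt0.
have i2 : 'i%C ^+ 2 = -1 :> R[i] by apply: sqr_i.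
have i4 : (- 'i%C) ^+ 4 = 1 :> R[i].
  by rewrite (exprM _ 2 2) sqrrN i2 sqrrN expr1n.
have nz_i : 'i%C != 0 :> R[i].
  by apply: contra_eqN i2 => /eqP ->; rewrite expr0n eq_sym oppr_eq0 oner_eq0.
have [|w prim_w] := @closed_prim_root_exists R[i] m.+1.
  by rewrite pnatr_eq0.
rewrite (det_lcir_cvec prim_w nz_i) -(expr_mod m.+1 i4) /=.
(* Here [n = m.+1], so [r] is one less than the residue of [n], which is nonzero. *)
have split_m r : m.+1 = r.+1 %[mod 4] -> (r < 3)%N -> m = (m %/ 4 * 4 + r)%N.
  move=> /eqP + r3; rewrite -addn1 -(addn1 r) eqn_modDr => /eqP e.
  by rewrite {1}(divn_eq m 4) e (modn_small (leqW r3)).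
have half q r : (q * 4 + 2 * r = 2 * (q * 2 + r))%N.
  by rewrite mulnDr mulnCA.
have sqr1Di : (1 + 'i%C) ^+ 2 = 2 * 'i%C :> R[i].
  by rewrite sqrrD i2 expr1n mul1r addrAC subrr add0r mulr_natl.
have sqr1Bi : (1 - 'i%C) ^+ 2 = - (2 * 'i%C) :> R[i].
  by rewrite sqrrB i2 expr1n mul1r addrAC subrr add0r mulr_natl.
(* The difference [C(k+4, 2) - C(k, 2) = 4k + 6] is even. *)
have sgn q r : (-1) ^+ 'C(q * 4 + r, 2) = (-1) ^+ 'C(r, 2) :> R[i].
  elim: q => // q <-; rewrite mulSn -addnA -signr_odd -[RHS]signr_odd.
  move: (q * 4 + r)%N => k; congr (_ ^+ (nat_of_bool _)).
  rewrite !addSn add0n !binS !bin1 !bin0 !oddD.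
  by case: (odd 'C(k, 2)); case: (odd k).
split=> [->|[] e|e].
(* The base is 0, and its exponent [m] is positive because [n >= 2]. *)
- by rewrite expr0 subrr expr0n gtn_eqF // mulr0.
- rewrite e (split_m 0) // sgn mul1r opprK (half _ 0) exprM sqr1Di.
  by rewrite mulKn.
(* The base is [1 - i], with square [-2i]; its odd power [2q + 1] gives a minus sign that cancels
   [(-1)^C(2, 2)]. *)
- rewrite e (split_m 2) // sgn (half _ 1) mulKn // exprM (exprS _ 2) sqrrN i2.
  rewrite mulrN1 opprK sqr1Bi binn addn1 !exprS (mulnC _ 2) !exprM sqrrN.
  by rewrite mulr1 mulrA mulrNN mul1r.
- by rewrite e (split_m 1) // sgn mul1r sqrrN i2 opprK.
Qed.
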